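(* Let $G$ be a finite bipartite graph with $\xi(G)=1$. Then $G$ has exactly one isolated vertex and $|V(G)|$ is odd.
   Context: $\Omega(G)$ is the set of maximum stable sets of $G$; $core(G)=\bigcap\{S:S\in\Omega(G)\}$ and $\xi(G)=|core(G)|$. *)

(* Defs.v *)
(* A finite simple graph is a symmetric, irreflexive
   adjacency relation [e] on a vertex type [T : finType], so V(G) = [set: T]. *)
From mathcomp Require Import all_boot.

Set Implicit Arguments.
Unset Strict Implicit.
Unset Printing Implicit Defensive.

Section Graph.
Variables (T : finType) (e : rel T).

Definition stable (S : {set T}) : bool :=
  [forall x in S, forall y in S, ~~ e x y].

Definition alpha : nat := \max_(S : {set T} | stable S) #|S|.

Definition Omega : {set {set T}} := [set S | stable S & #|S| == alpha].

(* [Omega] is never empty (set0 is stable), so this is a genuine intersection. *)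
Definition core : {set T} := \bigcap_(S in Omega) S.

Definition xi : nat := #|core|.

(* Either colour class may be empty, so edgeless graphs are bipartite. *)
Definition bipartite : Prop :=
  exists A B : {set T},
    [/\ A :|: B = [set: T], [disjoint A & B], stable A & stable B].

Definition isolated (v : T) : bool := [forall w, ~~ e v w].

End Graph.

(* Main.v *)
(** Let [A], [B] be the colour classes.  If [S1] and [S2] are maximum stable
    sets, then so is the set that meets [A] in the intersection and [B] in the
    union of [S1] and [S2], since it and its mirror image are stable and their
    sizes add up to [2 * alpha].  Hence some maximum stable set meets [A] exactly
    in the core, and likewise for [B].  Let the core be [[set v]] with [v] in [A].
    A maximum stable set missing [B] shows that [A] is maximum; [B] is not,
    because it misses [v]; so a maximum stable set meeting [A] in [v] alone must
    be [v |: B].  Thus [v] is isolated and [#|A| = #|B| + 1]. *)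
Require Import Defs.
From mathcomp Require Import all_boot zify.

Section StableSets.
Variables (T : finType) (e : rel T).

Lemma stableP (S : {set T}) :
  reflect {in S &, forall x y, ~~ e x y} (stable e S).
Proof.
apply: (iffP forall_inP) => [st x y Sx Sy | st x Sx].
  exact: (forall_inP (st x Sx)).
by apply/forall_inP => y Sy; apply: st.
Qed.

Lemma OmegaP (S : {set T}) :
  reflect (stable e S /\ #|S| = alpha e) (S \in Omega e).
Proof. by rewrite inE; apply: (iffP andP) => -[st /eqP]. Qed.

Lemma leq_alpha (S : {set T}) : stable e S -> #|S| <= alpha e.
Proof.
exact: (@leq_bigmax_cond _ (fun S => stable e S) (fun S : {set T} => #|S|)).
Qed.

Lemma Omega_neq0 : exists S, S \in Omega e.
Proof.
have st0 : stable e set0 by apply/stableP => x y; rewrite inE.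
have [|S st alphaE] :=
  @eq_bigmax_cond _ (fun S => stable e S) (fun S : {set T} => #|S|).
  by apply/card_gt0P; exists set0.
by exists S; apply/OmegaP; rewrite /alpha alphaE.
Qed.

(** A maximum stable set missing [v] could be enlarged by [v]. *)
Lemma isolated_core (v : T) :
  symmetric e -> irreflexive e -> isolated e v -> v \in core e.
Proof.
move=> e_sym e_irr /forallP iso; apply/bigcapP => S /OmegaP[/stableP st cardS].
apply: contraT => vNS.
suff /leq_alpha : stable e (v |: S) by rewrite cardsU1 vNS cardS ltnn.
apply/stableP => x y /setU1P[-> | Sx] /setU1P[-> | Sy] //; last exact: st.
by rewrite e_sym.
Qed.

(** Each vertex of the [A] part lies in both [S1] and [S2], so it shares a stable set with any
    vertex of the [B] part. *)
Lemma stable_cross (A B S1 S2 : {set T}) :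
  symmetric e -> stable e A -> stable e B -> stable e S1 -> stable e S2 ->
  stable e (A :&: (S1 :&: S2) :|: B :&: (S1 :|: S2)).
Proof.
move=> e_sym /stableP stA /stableP stB /stableP st1 /stableP st2.
have mixed x y : x \in A :&: (S1 :&: S2) -> y \in B :&: (S1 :|: S2) -> ~~ e x y.
  move=> /setIP[_ /setIP[x1 x2]] /setIP[_ /setUP[y1 | y2]].
    exact: st1.
  exact: st2.
apply/stableP => x y /setUP[xA | xB] /setUP[yA | yB].
- by case/setIP: xA => xA _; case/setIP: yA => yA _; apply: stA.
- exact: mixed.
- by rewrite e_sym mixed.
- by case/setIP: xB => xB _; case/setIP: yB => yB _; apply: stB.
Qed.

Section Bipartition.
Variables A B : {set T}.
Hypotheses (e_sym : symmetric e) (AB : A :|: B = [set: T]).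
Hypotheses (disAB : [disjoint A & B]) (stA : stable e A) (stB : stable e B).

Lemma card_bipartition (S : {set T}) : #|S| = #|A :&: S| + #|B :&: S|.
Proof.
have dis : [disjoint A :&: S & B :&: S].
  by apply: disjointW disAB; apply: subsetIl.
move: (leq_card_setU (A :&: S) (B :&: S)).
by rewrite -setIUl AB setTI => -[_]; rewrite dis => /eqP.
Qed.

Lemma card_cross (X Y : {set T}) :
  #|A :&: X :|: B :&: Y| = #|A :&: X| + #|B :&: Y|.
Proof.
apply/eqP; rewrite (leq_card_setU _ _).2.
by apply: disjointW disAB; apply: subsetIl.
Qed.

Lemma Omega_cross (S1 S2 : {set T}) :
  S1 \in Omega e -> S2 \in Omega e ->
  A :&: (S1 :&: S2) :|: B :&: (S1 :|: S2) \in Omega e.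
Proof.
move=> /OmegaP[st1 card1] /OmegaP[st2 card2].
have st := stable_cross _ _ _ _ e_sym stA stB st1 st2.
(* The mirror image has at most [alpha e] vertices, which bounds the size of the crossed set from
   below. *)
have st' := stable_cross _ _ _ _ e_sym stB stA st1 st2.
apply/OmegaP; split=> //; apply/eqP; rewrite eqn_leq leq_alpha //=.
move: (leq_alpha _ st') card1 card2; rewrite setUC !card_cross.
rewrite (card_bipartition S1) (card_bipartition S2).
have := cardsUI (A :&: S1) (A :&: S2); have := cardsUI (B :&: S1) (B :&: S2).
rewrite -!setIUr -!setIIr; lia.
Qed.

(** Take [S] with the smallest trace on [A]: crossing it with any [S'] cannot shrink that trace, so
    [A :&: S] lies in [S']. *)
Lemma Omega_inter_core : exists2 S, S \in Omega e & A :&: S \subset core e.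
Proof.
have [S0 S0max] := Omega_neq0.
have [S Smax minS] := @arg_minnP _ S0 (mem (Omega e)) (fun S => #|A :&: S|) S0max.
exists S => //; apply/bigcapsP => S' S'max.
have := minS _ (Omega_cross _ _ Smax S'max).
rewrite setIUr !setIA setIid (disjoint_setI0 disAB) set0I setU0.
move=> le; have /eqP <- : A :&: S :&: S' == A :&: S.
  by rewrite eqEcard subsetIl.
exact: subsetIr.
Qed.

End Bipartition.

Lemma core_set1_bipartition (A B : {set T}) (v : T) :
  symmetric e -> A :|: B = [set: T] -> [disjoint A & B] ->
  stable e A -> stable e B -> core e = [set v] -> v \in A ->
  isolated e v /\ odd #|T|.
Proof.
move=> e_sym AB disAB stA stB coreE vA.
have vNB : v \notin B by rewrite (disjointFr disAB).
have inOmega S : S \in Omega e -> v \in S.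
  by move=> Smax; have /bigcapP/(_ S Smax) : v \in core e by rewrite coreE set11.
have BA : B :|: A = [set: T] by rewrite setUC.
have disBA : [disjoint B & A] by rewrite disjoint_sym.
have [M /OmegaP[_ cardM]] := Omega_inter_core _ _ e_sym BA disBA stB stA.
rewrite coreE => MB.
have MB0 : B :&: M = set0.
  apply/setP => x; rewrite in_set0; apply: contraNF vNB => xBM.
  by have /set1P <- := subsetP MB x xBM; case/setIP: xBM.
have cardA : #|A| = alpha e.
  apply/eqP; rewrite eqn_leq leq_alpha //= -cardM (card_bipartition _ _ AB disAB).
  by rewrite MB0 cards0 addn0 subset_leq_card ?subsetIl.
have [N Nmax] := Omega_inter_core _ _ e_sym AB disAB stA stB.
rewrite coreE => NA; have [/stableP stN cardN] := OmegaP _ Nmax.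
have vN := inOmega _ Nmax.
have NAv : A :&: N = [set v].
  by apply/eqP; rewrite eqEsubset NA sub1set inE vA.
(* Were [B] maximum, it would contain the core vertex [v]. *)
have cardB : #|B| < alpha e.
  rewrite ltn_neqAle leq_alpha // andbT; apply: contraNneq vNB => cardB.
  by apply/inOmega/OmegaP.
move: cardN; rewrite (card_bipartition _ _ AB disAB) NAv cards1 => cardN.
(* By [cardN], [B :&: N] has [alpha e - 1] vertices, hence at least as many as [B]. *)
have BN : B \subset N.
  by apply/setIidPl/eqP; rewrite eqEcard subsetIl -ltnS -[in X in _ < X]add1n cardN.
move: (cardN); rewrite (setIidPl BN) => cardB1; split.
  (* Both [v] and [B] lie in the stable set [N]. *)
  apply/forallP => w; have /setUP[wA | wB] : w \in A :|: B by rewrite AB inE.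
    by move/stableP: stA; apply.
  by apply: stN => //; apply: (subsetP BN).
rewrite -cardsT (card_bipartition _ _ AB disAB) !setIT cardA -cardB1.
by rewrite add1n addSn addnn /= odd_double.
Qed.

End StableSets.

Theorem theorem8 (T : finType) (e : rel T)
    (e_sym : symmetric e) (e_irr : irreflexive e)
    (bip : bipartite e) (xi1 : xi e = 1) :
  (exists! v : T, isolated e v) /\ odd #|T|.
Proof.
have [v coreE] := cards1P (introT eqP xi1).
have [A [B [AB disAB stA stB]]] := bip.
have [iso oddT] : isolated e v /\ odd #|T|.
  have /setUP[vA | vB] : v \in A :|: B by rewrite AB inE.
    exact: (core_set1_bipartition _ _ A B).
  (* The colour classes play symmetric roles. *)
  by apply: (core_set1_bipartition _ _ B A); rewrite // 1?setUC 1?disjoint_sym.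
(* Uniqueness: any isolated vertex lies in the core, which is [[set v]]. *)
split=> //; exists v; split=> // w /(isolated_core _ _ _ e_sym e_irr).
by rewrite coreE => /set1P.
Qed.
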